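(* Let $n$ be a positive integer. Then the number of distinct periodic power maps over $\mathbb{Z}/n\mathbb{Z}$ is $$\mu_P(\mathbb{Z}/n\mathbb{Z}) = \sum_{\substack{d \mid \operatorname{rad}(n/\operatorname{rad}(n)) \\ d \neq 1}} (-1)^{\omega(d)-1}\left\lfloor \frac{\lambda(n) + E(n) - 1}{d} \right\rfloor.$$
   Context: A power map over a ring $R$ is a function $R \to R$ of the form $f(x) = x^m$ for a fixed positive integer $m$; distinct means distinct as functions. A power map $f$ is periodic if there is a nonzero $h \in R$ with $f(x+h) = f(x)$ for all $x \in R$; $\mu_P(R)$ is the number of distinct periodic power maps over $R$. For $n = p_1^{\beta_1}\cdots p_v^{\beta_v}$ (prime factorization), $E(n) = \max_i \beta_i$ and $\lambda(n) = \operatorname{lcm}(\lambda(p_1^{\beta_1}), \ldots, \lambda(p_v^{\beta_v}))$ is the Carmichael function, where $\lambda(p^\beta) = 2^{\beta-2}$ if $p = 2$ and $\beta \geq 3$, and $\lambda(p^\beta) = p^{\beta-1}(p-1)$ otherwise. (For $n = 1$ the sum is empty, so the value of $E(1)$ is immaterial.) $\operatorname{rad}(m)$ is the product of the distinct prime factors of $m$, and $\omega(d)$ is the number of distinct prime factors of $d$. The sum runs over positive divisors $d$. *)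

(* Defs.v *)
From HB Require Import structures.
From mathcomp Require Import all_boot all_algebra.
From mathcomp Require Import boolp.

Set Implicit Arguments.
Unset Strict Implicit.
Unset Printing Implicit Defensive.

Import GRing.Theory.

Local Open Scope ring_scope.

(* The ring Z/nZ for n > 0.  MathComp's 'Z_n is Z/2Z at n = 1 and 'I_n.+1
   carries no ring structure at n = 0, so zmodp's modular operations are
   packaged here as a possibly zero ring.  For n > 0 the carrier 'I_n.-1.+1 is
   'I_n; n = 0 is junk (the zero ring). *)
Definition Zmod (n : nat) : Type := 'I_n.-1.+1.

HB.instance Definition _ (n : nat) := Finite.on (Zmod n).
HB.instance Definition _ (n : nat) := GRing.Zmodule.on (Zmod n).

Fact Zmod_mul_addl (n : nat) :
  left_distributive (@Zp_mul n.-1.+1 : Zmod n -> Zmod n -> Zmod n) +%R.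
Proof. exact: Zp_mul_addl. Qed.

HB.instance Definition _ (n : nat) :=
  GRing.Zmodule_isComPzRing.Build (Zmod n)
    (@Zp_mulA _) (@Zp_mulC _) (@Zp_mul1z _) (@Zmod_mul_addl n).

Definition power_map (R : pzRingType) (f : R -> R) : Prop :=
  exists2 m : nat, (0 < m)%N & forall x : R, f x = x ^+ m.

Definition periodic (R : pzRingType) (f : R -> R) : Prop :=
  exists2 h : R, h != 0 & forall x : R, f (x + h) = f x.

(* Equality in {ffun R -> R} is extensional, so each function is counted once
   however many exponents represent it. *)
Definition muP (R : finPzRingType) : nat :=
  #|[set f : {ffun R -> R} | `[< power_map f /\ periodic f >]]|.

Local Open Scope nat_scope.

Definition radn (m : nat) : nat := \prod_(p <- primes m) p.

Definition omega (d : nat) : nat := size (primes d).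

(* max_exponent 1 = 0 by convention. *)
Definition max_exponent (n : nat) : nat := \max_(p <- primes n) logn p n.

Definition carmichael_pp (p b : nat) : nat :=
  if (p == 2) && (3 <= b) then 2 ^ (b - 2) else p ^ (b - 1) * (p - 1).

Definition carmichael (n : nat) : nat :=
  \big[lcmn/1]_(p <- primes n) carmichael_pp p (logn p n).

(* Main.v *)
Require Import Defs.
From mathcomp Require Import all_boot all_algebra cyclic finfield boolp.
From mathcomp Require Import zify.

(** Why the formula holds.  Write L for the Carmichael value of n and E for its
largest prime exponent.

The exponents a < b define the same function on Z/nZ exactly when a >= E and
L divides b - a: modulo each prime power of n, a multiple of the prime is
killed by the power E, and a unit x satisfies x ^ L = 1, while L is the exact
exponent of the unit group ([carmichael_pp_exp], [carmichael_pp_dvd]).  So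
each power map is given by exactly one exponent in the range 1..L + E - 1
([expn_inj_range], [expn_range]); only n = 1, where that range is empty and
nothing is periodic, falls outside.

The periods of x ^ m form a subgroup of Z/nZ, so if there is a nonzero period
there is one of the form t = n / p with p prime.  Comparing the values at 0
and t shows that p ^ 2 divides n; comparing them at 1 and 1 + t, where
(1 + t) ^ m = 1 + m t modulo n, shows that p divides m.  Conversely these two
divisibilities make n / p a period.  Hence x ^ m is periodic if and only if m
shares a prime factor with rad (n / rad n), whose prime factors are the primes
with p ^ 2 dividing n ([periodic_exponentP]).

It remains to count the m in 1..L + E - 1 that are not coprime to
rad (n / rad n), which is inclusion-exclusion over its divisors
([sum_noncoprime]). *)

Import GRing.Theory.
Local Open Scope nat_scope.

(** * Exponent of the unit group modulo a prime power *)

Lemma expnD_mod2 (x z k : nat) :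
  exists w, (x + z) ^ k = x ^ k + k * x ^ k.-1 * z + z ^ 2 * w.
Proof.
elim: k => [|[|k] [w IHk]]; first by exists 0; rewrite muln0.
  by exists 0; rewrite !expn1 expn0; lia.
exists (w * (x + z) + k.+1 * x ^ k).
by rewrite expnSr IHk /= (expnS x k.+1) (expnS x k); nia.
Qed.

Lemma expn1D_mod3 (z k : nat) :
  exists w, (1 + z) ^ k = 1 + k * z + 'C(k, 2) * z ^ 2 + z ^ 3 * w.
Proof.
elim: k => [|k [w IHk]]; first by exists 0; rewrite bin0n muln0.
exists (w * (1 + z) + 'C(k, 2)).
by rewrite expnSr IHk binS bin1; nia.
Qed.

Lemma modn1_ex (y M : nat) : 1 < M -> y = 1 %[mod M] -> exists q, y = 1 + M * q.
Proof.
move=> M1 yM; exists (y %/ M).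
by rewrite {1}(divn_eq y M) yM modn_small // addnC mulnC.
Qed.

Lemma modn_1D (M q : nat) : 1 + M * q = 1 %[mod M].
Proof. by rewrite addnC mulnC modnMDl. Qed.

(** Raising to the power p gains exactly one factor p in y - 1.  In
(1 + z) ^ p = 1 + p z + 'C(p, 2) z ^ 2 + ..., with z of valuation s, every term
after p z has valuation at least s + 2: for odd p because p divides 'C(p, 2),
and for p = 2 because 2 s >= s + 2 once s >= 2. *)
Lemma exp_prime_1D (p s u : nat) : prime p -> 0 < s -> (p == 2) ==> (1 < s) ->
  coprime p u ->
  exists2 v, coprime p v & (1 + p ^ s * u) ^ p = 1 + p ^ s.+1 * v.
Proof.
move=> p_pr s_gt0 s_big cop_pu.
have [w ->] := expn1D_mod3 (p ^ s * u) p.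
have [c Dc] : exists c, 'C(p, 2) * (p ^ s) ^ 2 = p ^ s.+1 * (p * c).
  rewrite -expnM; case: eqP s_big => [-> /= s_gt1 | p_neq2 _].
    exists (2 ^ (s * 2 - s - 2)).
    by rewrite binn mul1n -expnS -expnD; congr (_ ^ _); lia.
  have p_gt2 : 2 < p by have := prime_gt1 p_pr; lia.
  have /dvdnP[b ->] : p %| 'C(p, 2) by apply: prime_dvd_bin.
  exists (b * p ^ (s - 1)).
  rewrite [RHS](_ : _ = b * (p ^ s.+1 * (p ^ 1 * p ^ (s - 1)))); last first.
    by rewrite expn1; nia.
  rewrite -!expnD -mulnA -expnS; congr (_ * _ ^ _); lia.
have [e De] : exists e, (p ^ s) ^ 3 = p ^ s.+1 * (p * e).
  exists (p ^ (s * 3 - s - 2)).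
  by rewrite -expnM -expnS -expnD; congr (_ ^ _); lia.
exists (u + p * (c * u ^ 2 + e * u ^ 3 * w)).
  by rewrite !prime_coprime // in cop_pu *; rewrite dvdn_addl // dvdn_mulr.
rewrite (expnMn _ u 2) (expnMn _ u 3) (mulnA 'C(p, 2)) Dc De (expnS p s); nia.
Qed.

(** The order of 1 + p ^ s u modulo p ^ (s + j) is a multiple of p ^ j: modulo
p ^ (s + 1) the power k is 1 + k p ^ s u, which forces p to divide k, and then
the p-th power of the base has the same form with s + 1 in place of s. *)
Lemma dvdn_exp1D (p s u k j : nat) : prime p -> 0 < s -> (p == 2) ==> (1 < s) ->
  coprime p u -> (1 + p ^ s * u) ^ k = 1 %[mod p ^ (s + j)] -> p ^ j %| k.
Proof.
move=> p_pr; elim: j s u k => [|j IHj] s u k s_gt0 s_big cop_pu.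
  by rewrite dvd1n.
have p_gt1 := prime_gt1 p_pr.
move=> yk1; have /dvdnP[k' Dk] : p %| k.
  have [w Dw] := expnD_mod2 1 (p ^ s * u) k; rewrite !exp1n muln1 in Dw.
  have yk1s : (1 + p ^ s * u) ^ k = 1 %[mod p ^ s.+1].
    have dv : p ^ s.+1 %| p ^ (s + j.+1) by apply: dvdn_exp2l; lia.
    by rewrite -(modn_dvdm _ dv) yk1 modn_dvdm.
  have /eqP := yk1s; rewrite Dw -addnA eqn_mod_dvd ?leq_addr // addKn dvdn_addl.
    rewrite mulnCA expnSr dvdn_pmul2l ?expn_gt0 ?(ltnW p_gt1) //.
    by rewrite Gauss_dvdl.
  apply: dvdn_mulr; rewrite expnMn dvdn_mulr // -expnM dvdn_exp2l //; lia.
rewrite Dk expnS mulnC dvdn_pmul2r ?(ltnW p_gt1) //.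
have [v cop_pv Dv] := @exp_prime_1D p s u p_pr s_gt0 s_big cop_pu.
apply: (IHj s.+1 v) => //; first by apply/implyP.
by rewrite -Dv -expnM [p * _]mulnC -Dk [s.+1 + j]addSnnS.
Qed.

(** The square of 1 + 2 ^ i q is 1 modulo 2 ^ (i + 1); the gain of the exponent
2 ^ (b - 2) over the totient 2 ^ (b - 1) comes from the start of the induction,
since an odd square is already 1 modulo 8. *)
Lemma odd_exp_2power (x e : nat) : odd x -> x ^ 2 ^ e.+1 = 1 %[mod 2 ^ e.+3].
Proof.
move=> x_odd; elim: e => [|e IHe].
  have ->: x = (x./2).*2 + 1 by rewrite -{1}(odd_double_half x) x_odd addnC.
  have [q Dq] : exists q, x./2 * (x./2).+1 = q * 2.
    by apply/dvdnP; rewrite dvdn2 oddM /=; case: (odd _).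
  rewrite !expnS expn0 !muln1 (_ : _ * _ = 1 + 8 * q); last by nia.
  exact: (modn_1D 8).
have [|q Dq] := modn1_ex _ _ _ IHe; first by rewrite -{1}(expn0 2) ltn_exp2l.
rewrite [2 ^ e.+2]expnSr expnM Dq.
rewrite (_ : _ ^ 2 = 1 + 2 ^ e.+4 * (q + 2 ^ e.+2 * q ^ 2)) ?modn_1D //.
rewrite !expnS expn0; nia.
Qed.

Lemma carmichael_pp_exp (p b x : nat) : prime p -> 0 < b -> coprime p x ->
  x ^ carmichael_pp p b = 1 %[mod p ^ b].
Proof.
move=> p_pr b_gt0 cop_px; rewrite /carmichael_pp.
case: ifP => [/andP[/eqP Dp b_gt2]|_].
  have ->: b = (b - 3).+3 by lia.
  rewrite Dp (_ : _ - 2 = (b - 3).+1); last by lia.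
  by apply: odd_exp_2power; rewrite -coprime2n -Dp.
rewrite mulnC !subn1 -totient_pfactor //; apply: Euler_exp_totient.
by rewrite coprime_sym coprime_pexpl.
Qed.

(** The multiplicative group of the field with p elements is cyclic, so a
primitive root detects divisibility by p - 1. *)
Lemma dvdn_pred_prime (p k : nat) : prime p ->
  (forall x, coprime p x -> x ^ k = 1 %[mod p]) -> p - 1 %| k.
Proof.
move=> p_pr xk1; have p_gt1 := prime_gt1 p_pr.
have [||||z _ z_prim] := hasP (@has_prim_root 'F_p p.-1 (enum [pred x | x != 0%R]) _ _ _ _).
- by lia.
- apply/allP=> x; rewrite mem_enum inE => x_neq0.
  rewrite unity_rootE; apply/eqP/(mulfI x_neq0).
  rewrite mulr1 -exprS prednK ?prime_gt0 //.
  by have := expf_card x; rewrite card_Fp.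
- exact: enum_uniq.
- by rewrite -cardE cardC1 card_Fp.
rewrite subn1 (prim_order_dvd z_prim).
have z_neq0 : z != 0%R.
  apply/eqP=> z0; have /eqP := prim_expr_order z_prim.
  rewrite z0 expr0n (_ : (p.-1 == 0) = false) ?[_ == 1%R]eq_sym ?oner_eq0 //; lia.
have Dz : z = (z%:R)%R by rewrite natr_Zp.
have cop_pz : coprime p z.
  rewrite prime_coprime //; apply: contraNN z_neq0 => p_dv_z.
  by rewrite Dz -(dvdn_pcharf (pchar_Fp p_pr)).
rewrite Dz -natrX; apply/eqP/ord_inj.
by rewrite val_Fp_nat // xk1 // -val_Fp_nat.
Qed.

(** Together with [carmichael_pp_exp], this makes [carmichael_pp p b] the exact
exponent of the unit group.  The power of p is detected by the unit 1 + p, or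
by 5 = 1 + 2 ^ 2 if p = 2, and the coprime factor p - 1 by a primitive root
modulo p. *)
Lemma carmichael_pp_dvd (p b k : nat) : prime p -> 0 < b ->
  (forall x, coprime p x -> x ^ k = 1 %[mod p ^ b]) -> carmichael_pp p b %| k.
Proof.
move=> p_pr b_gt0 xk1; have p_gt1 := prime_gt1 p_pr.
have cop1D s : 0 < s -> coprime p (1 + p ^ s * 1).
  move=> s_gt0; rewrite muln1 prime_coprime // dvdn_addl ?dvdn_exp ?dvdn1 //.
  lia.
rewrite /carmichael_pp; case: ifP => [/andP[/eqP Dp b_gt2]|not2].
  subst p.
  apply: (@dvdn_exp1D 2 2 1) => //; rewrite ?coprimen1 ?implybT // subnKC.
    exact/xk1/cop1D.
  by lia.
have p_dv x : coprime p x -> x ^ k = 1 %[mod p].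
  have dv : p %| p ^ b by rewrite dvdn_exp.
  by move=> cop_px; rewrite -(modn_dvdm _ dv) xk1 // modn_dvdm.
rewrite Gauss_dvd ?dvdn_pred_prime //; last first.
  by apply: coprimeXl; rewrite subn1 coprime_sym coprimePn ?prime_gt0.
rewrite andbT; case: (eqVneq p 2) not2 => [Dp /negbT|p_neq2 _]; last first.
  apply: (@dvdn_exp1D p 1 1) => //; rewrite ?coprimen1 ?(negPf p_neq2) // subnKC //.
  exact/xk1/cop1D.
rewrite -leqNgt => b_le2.
have [-> | Db] : b = 1 \/ b = 2 by lia.
  by rewrite expn0 dvd1n.
(* The modulus is 4, where 3 has order 2. *)
have := xk1 3; rewrite Db Dp => /(_ isT) /eqP k3; rewrite dvdn2.
apply: contraTN k3 => k_odd.
have ->: k = 1 + 2 * k./2 by rewrite -{1}[k]odd_double_half k_odd; lia.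
by rewrite expnD expnM -modnMm -[_ ^ k./2 %% _]modnXm -[3 ^ 2 %% _]/1 exp1n.
Qed.

(** * Exponents defining the same power map *)

Lemma eqn_mod_primes (n a b : nat) : 0 < n ->
  (forall p, p \in primes n -> a = b %[mod p ^ logn p n]) -> a = b %[mod n].
Proof.
wlog le_ba : a b / b <= a => [IH n_gt0 ab | n_gt0 ab].
  case: (leqP b a) => [|/ltnW] le; first exact: IH.
  by apply/esym/IH => // p /ab.
apply/eqP; rewrite eqn_mod_dvd //; apply/dvdn_partP => // p pn.
by rewrite p_part -eqn_mod_dvd //; apply/eqP/ab.
Qed.

Lemma carmichael_pp_dvd_carmichael (n p : nat) : p \in primes n ->
  carmichael_pp p (logn p n) %| carmichael n.
Proof. by move=> pn; rewrite /carmichael (big_rem p) //= dvdn_lcml. Qed.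

Lemma carmichael_dvd (n k : nat) :
  (forall p, p \in primes n -> carmichael_pp p (logn p n) %| k) ->
  carmichael n %| k.
Proof.
move=> dv; rewrite /carmichael big_seq.
by elim/big_ind: _ => [|a b ak bk|p /dv //]; rewrite ?dvd1n // dvdn_lcm ak.
Qed.

Lemma carmichael_gt0 (n : nat) : 0 < carmichael n.
Proof.
rewrite /carmichael big_seq; elim/big_ind: _ => // [a b|p].
  by rewrite lcmn_gt0 => -> ->.
rewrite mem_primes => /andP[/prime_gt1 p_gt1 _]; rewrite /carmichael_pp.
by case: ifP => _; rewrite ?muln_gt0 ?subn_gt0 ?expn_gt0 ?p_gt1 ?(ltnW p_gt1).
Qed.

(** Modulo each prime power of n, either p divides x and both powers vanish, or
x is a unit and the extra factor is 1. *)
Lemma expn_carmichael (n a x : nat) : 0 < n -> max_exponent n <= a ->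
  x ^ (a + carmichael n) = x ^ a %[mod n].
Proof.
move=> n_gt0 le_Ea; apply: eqn_mod_primes => // p pn.
have p_pr : prime p by move: pn; rewrite mem_primes => /andP[].
have le_ba : logn p n <= a by apply: leq_trans le_Ea; apply: leq_bigmax_seq.
have [p_x|cop_px] := boolP (p %| x).
  have dv c : a <= c -> x ^ c = 0 %[mod p ^ logn p n].
    move=> le_ac; apply/eqP; rewrite mod0n.
    exact: dvdn_trans (dvdn_exp2l p (leq_trans le_ba le_ac)) (dvdn_exp2r c p_x).
  by rewrite !dv ?leq_addr.
rewrite -prime_coprime // in cop_px.
have /dvdnP[c ->] := carmichael_pp_dvd_carmichael _ _ pn.
rewrite expnD [c * _]mulnC expnM -modnMmr -modnXm carmichael_pp_exp ?logn_gt0 //.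
by rewrite modnXm exp1n modnMmr muln1.
Qed.

(** Here n divides x ^ a (x ^ (b - a) - 1) for every x.  At x = p the second
factor is prime to p, so p ^ a absorbs the whole p-part of n; at x prime to p
the first factor is a unit, so b - a is an exponent of the unit group. *)
Lemma expn_eq_bounds (n a b : nat) : 0 < n -> a < b ->
  (forall x, x ^ a = x ^ b %[mod n]) ->
  max_exponent n <= a /\ carmichael n <= b - a.
Proof.
move=> n_gt0 lt_ab xab.
have dv x p : p \in primes n -> p ^ logn p n %| x ^ a * (x ^ (b - a) - 1).
  move=> pn; rewrite mulnBr muln1 -expnD subnKC ?(ltnW lt_ab) //.
  apply: dvdn_trans (pfactor_dvdnn p n) _.
  have [-> | x_gt0] := posnP x.
    by rewrite (exp0n (leq_ltn_trans _ lt_ab)).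
  by rewrite -eqn_mod_dvd ?leq_pexp2l ?(ltnW lt_ab) //; apply/eqP.
split.
  apply/bigmax_leqP_seq => p pn _; have := dv p p pn.
  have [p_pr p_gt1] : prime p /\ 1 < p.
    by move: pn; rewrite mem_primes => /andP[p_pr _]; rewrite prime_gt1.
  rewrite Gauss_dvdl ?dvdn_Pexp2l // coprimeXl // prime_coprime //.
  have pk : p %| p ^ (b - a) by rewrite dvdn_exp ?subn_gt0.
  apply/negP=> p_dv; have := dvdn_sub pk p_dv.
  by rewrite subKn ?expn_gt0 ?(ltnW p_gt1) // dvdn1; lia.
apply: dvdn_leq; first by rewrite subn_gt0.
apply: carmichael_dvd => p pn.
have p_pr : prime p by move: pn; rewrite mem_primes => /andP[].
apply: carmichael_pp_dvd; rewrite ?logn_gt0 // => x cop_px.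
have x_gt0 : 0 < x by case: x cop_px => //; rewrite /coprime gcdn0; case: (p) p_pr => [|[|]].
apply/eqP; rewrite eqn_mod_dvd ?expn_gt0 ?x_gt0 //.
by have := dv x p pn; rewrite Gauss_dvdr // coprimeXl // coprimeXr.
Qed.

Lemma expn_inj_range (n a b : nat) : 0 < n ->
  a <= carmichael n + max_exponent n - 1 ->
  b <= carmichael n + max_exponent n - 1 ->
  (forall x, x ^ a = x ^ b %[mod n]) -> a = b.
Proof.
move=> n_gt0 le_a le_b xab; have := carmichael_gt0 n.
case: (ltngtP a b) => // [lt_ab | lt_ba].
  have := expn_eq_bounds n _ _ n_gt0 lt_ab xab; lia.
have := expn_eq_bounds n _ _ n_gt0 lt_ba (fun x => esym (xab x)); lia.
Qed.

Lemma expn_range (n m : nat) : 0 < n -> 0 < max_exponent n -> 0 < m ->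
  exists2 k, 0 < k <= carmichael n + max_exponent n - 1 &
    forall x, x ^ m = x ^ k %[mod n].
Proof.
move=> n_gt0 E_gt0; have L_gt0 := carmichael_gt0 n.
elim/ltn_ind: m => m IHm m_gt0.
case: (leqP m (carmichael n + max_exponent n - 1)) => [le_m | gt_m].
  by exists m; rewrite ?m_gt0.
have [||k k_range mk] := IHm (m - carmichael n); [lia.. | exists k => // x].
by rewrite -mk -{1}(@subnK (carmichael n) m) ?expn_carmichael //; lia.
Qed.

(** * Radicals *)

Lemma dvdn_radn (p m : nat) : prime p -> 0 < m -> (p %| radn m) = (p %| m).
Proof.
move=> p_pr m_gt0; have -> : (p %| m) = (p \in primes m) by rewrite mem_primes p_pr m_gt0.
rewrite /radn Euclid_dvd_prod // big_has_cond -has_pred1.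
apply: eq_in_has => q; rewrite mem_primes => /andP[q_pr _] /=.
by rewrite dvdn_prime2 // eq_sym.
Qed.

Lemma all_prime_primes (n : nat) : all prime (primes n).
Proof. by apply/allP=> p; rewrite mem_primes => /andP[]. Qed.

Lemma prodn_prime_gt0 (s : seq nat) : all prime s -> 0 < \prod_(p <- s) p.
Proof.
by move=> s_pr; rewrite big_seq; apply: prodn_cond_gt0 => p /(allP s_pr)/prime_gt0.
Qed.

Lemma radn_gt0 (m : nat) : 0 < radn m.
Proof. exact/prodn_prime_gt0/all_prime_primes. Qed.

Lemma radn_dvd (m : nat) : 0 < m -> radn m %| m.
Proof.
move=> m_gt0; rewrite {2}(prod_prime_decomp m_gt0) prime_decompE big_map /=.
rewrite /radn big_seq [X in _ %| X]big_seq.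
elim/big_ind2: _ => // [a b c d|p pm]; first exact: dvdn_mul.
by rewrite dvdn_exp // logn_gt0.
Qed.

Lemma logn_prod_primes (p : nat) (s : seq nat) : uniq s -> all prime s ->
  logn p (\prod_(q <- s) q) = (p \in s).
Proof.
elim: s => [|q s IHs] /=; first by rewrite big_nil logn1.
case/andP=> qs s_uniq /andP[q_pr s_pr]; rewrite big_cons lognM ?(prime_gt0 q_pr) ?prodn_prime_gt0 //.
rewrite IHs // logn_prime // inE.
by case: (eqVneq p q) => // ->; rewrite (negPf qs).
Qed.

Lemma dvdn_rad_div (p n : nat) : prime p -> 0 < n ->
  (p %| radn (n %/ radn n)) = (p ^ 2 %| n).
Proof.
move=> p_pr n_gt0; have nr_gt0 : 0 < n %/ radn n.
  by rewrite divn_gt0 ?radn_gt0 // dvdn_leq ?radn_dvd.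
rewrite dvdn_radn // -[X in X %| _]expn1 !pfactor_dvdn //.
rewrite logn_div ?radn_dvd // logn_prod_primes ?primes_uniq ?all_prime_primes //.
by rewrite -logn_gt0; lia.
Qed.

(** * Inclusion-exclusion over divisors *)

Lemma omega_mul_prime (p d : nat) : prime p -> 0 < d -> ~~ (p %| d) ->
  omega (p * d) = (omega d).+1.
Proof.
move=> p_pr d_gt0 p_d; apply: (@perm_size _ _ (p :: primes d)).
apply: uniq_perm => [||q]; rewrite ?primes_uniq //=.
  by rewrite mem_primes p_pr d_gt0 p_d primes_uniq.
by rewrite primesM ?(prime_gt0 p_pr) // primes_prime // !inE.
Qed.

Lemma perm_divisors_mul_prime (p m : nat) : prime p -> 0 < m -> ~~ (p %| m) ->
  perm_eq (divisors (p * m)) (divisors m ++ [seq p * d | d <- divisors m]).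
Proof.
move=> p_pr m_gt0 p_m; have p_gt0 := prime_gt0 p_pr.
have mulpI : injective (muln p) by move=> a b /eqP; rewrite eqn_pmul2l // => /eqP.
apply: uniq_perm => [||d]; first exact: divisors_uniq.
  rewrite cat_uniq divisors_uniq map_inj_uniq // divisors_uniq andbT /=.
  apply/hasPn=> _ /mapP[d _ ->]; rewrite -dvdn_divisors //.
  by apply: contraNN p_m; apply: dvdn_trans; apply: dvdn_mulr.
rewrite mem_cat -!dvdn_divisors ?muln_gt0 ?p_gt0 //.
have [/dvdnP[c ->{d}] | p_d] := boolP (p %| d).
  rewrite [c * p]mulnC dvdn_pmul2l // mem_map // -dvdn_divisors //.
  by apply/idP/orP => [|[]]; [right | apply: dvdn_trans; apply: dvdn_mull | ].
rewrite Gauss_dvdr; last by rewrite coprime_sym prime_coprime.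
case: (d %| m) => //=; apply/esym/negP => /mapP[c _ Dd].
by rewrite Dd dvdn_mulr in p_d.
Qed.

Local Open Scope ring_scope.

(** Pairing d with p d for a prime p of the list: the paired terms cancel if p
divides m, and the p d term vanishes otherwise. *)
Lemma sum_sign_divisors (s : seq nat) (m : nat) : uniq s -> all prime s ->
  \sum_(d <- divisors (\prod_(p <- s) p)%N) (-1) ^+ omega d * (d %| m)%N%:Z
    = (coprime m (\prod_(p <- s) p)%N)%:Z.
Proof.
elim: s => [|p s IHs] /=.
  by rewrite big_nil coprimen1 big_seq1 expr0 dvd1n.
case/andP=> p_s s_uniq /andP[p_pr s_pr]; rewrite big_cons.
set P := (\prod_(q <- s) q)%N in IHs *.
have P_gt0 : (0 < P)%N by apply: prodn_prime_gt0.
have p_P : ~~ (p %| P)%N.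
  by rewrite -[p]expn1 pfactor_dvdn // logn_prod_primes // (negPf p_s).
rewrite (perm_big _ (perm_divisors_mul_prime _ _ p_pr P_gt0 p_P)) big_cat big_map /=.
rewrite coprimeMr [coprime m p]coprime_sym prime_coprime //.
rewrite -big_split /=.
have [p_m | p_m] := boolP (p %| m)%N; rewrite /= ?mul1n.
  rewrite big_seq big1 // => d; rewrite -dvdn_divisors // => d_P.
  have p_d : ~~ (p %| d)%N by apply: contraNN p_P => /dvdn_trans; apply.
  rewrite omega_mul_prime ?(dvdn_gt0 P_gt0) // Gauss_dvd ?prime_coprime // p_m.
  by rewrite exprS mulN1r mulNr subrr.
rewrite -(IHs s_uniq s_pr); apply: eq_bigr => d _.
rewrite [(p * d %| m)%N](_ : _ = false) ?mulr0 ?addr0 //.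
by apply: contraNF p_m; apply: dvdn_trans; apply: dvdn_mulr.
Qed.

Lemma sum_noncoprime (N k : nat) :
  (\sum_(1 <= m < N.+1) ~~ coprime m (radn k))%N%:Z =
    \sum_(d <- divisors (radn k) | d != 1%N)
      (-1) ^+ (omega d - 1)%N * (N %/ d)%N%:Z.
Proof.
set r := radn k; have r_gt0 : (0 < r)%N by apply: radn_gt0.
(* The d = 1 term of the signed sum is 1; moving it across the equality turns
   coprimality into its negation and shifts the sign exponent by one. *)
have noncoprimeE m : (~~ coprime m r)%:R =
    \sum_(d <- divisors r | d != 1%N)
      (-1) ^+ (omega d - 1)%N * (d %| m)%N%:Z :> int.
  have := sum_sign_divisors _ m (primes_uniq k) (all_prime_primes k).
  rewrite -/(radn k) -/r.
  rewrite (bigD1_seq 1%N) ?divisor1 ?divisors_uniq //= expr0 dvd1n mul1r => De.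
  transitivity (1 - (coprime m r)%:Z); first by case: coprime.
  rewrite -De opprD addrA subrr add0r -sumrN big_seq_cond [RHS]big_seq_cond.
  apply: eq_bigr => d /andP[]; rewrite -dvdn_divisors // => d_r d_neq1.
  have omega_gt0 : (0 < omega d)%N.
    rewrite lt0n size_eq0 primes_eq0.
    by have := dvdn_gt0 r_gt0 d_r; move: d_neq1; lia.
  by rewrite -{1}(prednK omega_gt0) exprS mulN1r mulNr opprK subn1.
rewrite -natz natr_sum; under eq_bigr => m _ do rewrite noncoprimeE.
rewrite exchange_big /=; apply: eq_bigr => d _.
rewrite -mulr_sumr divn_count_dvd -[in RHS]natz natr_sum.
by congr (_ * _); apply: eq_bigr => m _; rewrite natz.
Qed.

Local Open Scope nat_scope.

(** * Periodic exponents *)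

(** The periods are closed under addition and contain n, and Bezout writes the
gcd of h and n as a combination of the two. *)
Lemma period_gcd (n m h k : nat) : 0 < n -> 0 < h ->
  (forall x, (x + h) ^ m = x ^ m %[mod n]) -> gcdn h n %| k ->
  forall x, (x + k) ^ m = x ^ m %[mod n].
Proof.
move=> n_gt0 h_gt0 h_per /dvdnP[c ->] x.
have mul_per j : (x + j * h) ^ m = x ^ m %[mod n].
  by elim: j => [|j IHj]; rewrite ?addn0 // mulSn addnCA addnC h_per.
have [a _ /dvdnP[b]] := Bezoutl n h_gt0; rewrite gcdnC => Db.
have n_per y j : (y + j * n) ^ m = y ^ m %[mod n].
  by rewrite -modnXm addnC modnMDl modnXm.
rewrite -[LHS](n_per _ (c * a)).
rewrite (_ : _ + _ = x + c * b * h) ?mul_per //.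
by rewrite -addnA -[c * a * n]mulnA -mulnDr Db mulnA.
Qed.

Lemma periodic_exponentP (n m : nat) : 0 < n -> 0 < m ->
  (exists2 h, 0 < h < n & forall x, (x + h) ^ m = x ^ m %[mod n]) <->
  ~~ coprime m (radn (n %/ radn n)).
Proof.
move=> n_gt0 m_gt0; split=> [[h /andP[h_gt0 lt_hn] h_per]|].
  have g_dv := dvdn_gcdr h n; have g_gt0 : 0 < gcdn h n by rewrite gcdn_gt0 h_gt0.
  have lt_gn : gcdn h n < n by apply: leq_ltn_trans lt_hn; rewrite dvdn_leq ?dvdn_gcdl.
  have [p p_pr] : exists2 p, prime p & p %| n %/ gcdn h n.
    exists (pdiv (n %/ gcdn h n)); rewrite ?pdiv_dvd // pdiv_prime //.
    by rewrite ltn_divRL // mul1n.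
  (* t = n / p is a multiple of the gcd, hence a period. *)
  case/dvdnP=> c Dc; pose t := c * gcdn h n.
  have Dn : n = p * t by rewrite /t mulnA [p * c]mulnC -Dc divnK.
  have t_per x : (x + t) ^ m = x ^ m %[mod n].
    exact: (period_gcd n m h t n_gt0 h_gt0 h_per (dvdn_mull _ (dvdnn _))).
  have p_t : p %| t.
    have := t_per 0; rewrite add0n exp0n // mod0n => /eqP n_tm.
    have p_tm := dvdn_trans (dvdn_mulr t (dvdnn p)) (_ : p * t %| t ^ m).
    by move: p_tm; rewrite -Dn => /(_ n_tm); rewrite Euclid_dvdX // => /andP[].
  have t_gt0 : 0 < t by move: n_gt0; rewrite {1}Dn muln_gt0 => /andP[].
  have p_m : p %| m.
    have [w Dw] := expnD_mod2 1 t m.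
    have /eqP := t_per 1; rewrite Dw !exp1n muln1 -addnA eqn_mod_dvd ?leq_addr //.
    rewrite addKn dvdn_addl; first by rewrite {1}Dn dvdn_pmul2r.
    by rewrite {1}Dn dvdn_mulr // expnS expn1 dvdn_mul.
  apply/negP=> /(coprime_dvdl p_m); rewrite prime_coprime // dvdn_rad_div //.
  by rewrite {1}Dn expnS expn1 dvdn_mul.
move=> ncop; have [p p_pr] : exists2 p, prime p & p %| gcdn m (radn (n %/ radn n)).
  exists (pdiv (gcdn m (radn (n %/ radn n)))); rewrite ?pdiv_dvd // pdiv_prime //.
  by rewrite ltn_neqAle eq_sym ncop gcdn_gt0 m_gt0.
(* With n = d p ^ 2 the period is n / p = d p, whose square is a multiple of n. *)
rewrite dvdn_gcd dvdn_rad_div // => /andP[/dvdnP[c Dm] /dvdnP[d Dn]].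
have p_gt1 := prime_gt1 p_pr.
have {}Dn : n = d * p * p by rewrite Dn expnS expn1 mulnA.
have dp_gt0 : 0 < d * p by move: n_gt0; rewrite Dn muln_gt0 => /andP[].
exists (d * p) => [|x]; first by rewrite dp_gt0 Dn -{1}[d * p]muln1 ltn_pmul2l.
have [w ->] := expnD_mod2 x (d * p) m.
rewrite Dm (_ : _ + _ = (c * x ^ (c * p).-1 + d * w) * n + x ^ (c * p)) ?modnMDl //.
by rewrite Dn; nia.
Qed.

(** * Power maps on the residue ring *)

Lemma val_Zmod_exp (n : nat) (x : Zmod n) (k : nat) : 0 < n ->
  (x ^+ k)%R = x ^ k %% n :> nat.
Proof.
move=> n_gt0; elim: k => [|k IHk].
  by rewrite expr0 expn0 /= prednK.
rewrite exprS expnS -modnMmr -IHk /=.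
by congr (_ %% _); rewrite prednK.
Qed.

Lemma Zmod_power_eqP (n a b : nat) : 0 < n ->
  (forall x : Zmod n, x ^+ a = x ^+ b)%R <-> (forall x, x ^ a = x ^ b %[mod n]).
Proof.
move=> n_gt0; split=> xab x; last by apply/ord_inj; rewrite !val_Zmod_exp.
have := congr1 val (xab (inord (x %% n))); rewrite /= !val_Zmod_exp //.
by rewrite inordK ?modnXm // prednK // ltn_pmod.
Qed.

Lemma Zmod_periodicP (n m : nat) : 0 < n ->
  @periodic (Zmod n) (fun x => x ^+ m)%R <->
  (exists2 h, 0 < h < n & forall x, (x + h) ^ m = x ^ m %[mod n]).
Proof.
move=> n_gt0.
have val_expD (x h : Zmod n) : ((x + h) ^+ m)%R = (x + h) ^ m %% n :> nat.
  rewrite val_Zmod_exp // -[in RHS]modnXm; congr (_ ^ m %% n).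
  by rewrite /=; congr (_ %% _); rewrite prednK.
split=> [[h h_neq0 h_per] | [h /andP[h_gt0 lt_hn] h_per]].
  exists h => [|x].
    by rewrite lt0n h_neq0 -{2}(prednK n_gt0) ltn_ord.
  have := congr1 val (h_per (inord (x %% n))).
  rewrite /= val_expD val_Zmod_exp // inordK ?modnXm; last by rewrite prednK // ltn_pmod.
  by rewrite -modnXm modnDml modnXm.
have Dh : (inord h : 'I_n.-1.+1) = h :> nat by rewrite inordK // prednK.
exists (inord h : Zmod n) => [|x].
  by apply/eqP=> h0; move: h_gt0; rewrite -Dh h0.
by apply/ord_inj; rewrite val_expD val_Zmod_exp // Dh h_per.
Qed.

Local Open Scope ring_scope.

(* Since carmichael n >= 1, the natural-number subtraction never truncates. *)
Theorem mainTheorem8 (n : nat) (n_gt0 : (0 < n)%N) :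
  (muP (Zmod n))%:Z =
  \sum_(d <- divisors (radn (n %/ radn n)%N) | d != 1%N)
    (-1) ^+ (omega d - 1)%N * ((carmichael n + max_exponent n - 1) %/ d)%N%:Z.
Proof.
set r := radn _; set N := (_ - 1)%N.
rewrite -sum_noncoprime -/r.
congr Posz.
(* The index k : 'I_N stands for the exponent k.+1. *)
pose F (k : 'I_N) := [ffun x : Zmod n => x ^+ k.+1].
have F_inj : injective F.
  move=> j k /ffunP Fjk; apply/ord_inj/succn_inj.
  apply: (expn_inj_range n) (ltn_ord j) (ltn_ord k) _ => //.
  by apply/Zmod_power_eqP => // x; have := Fjk x; rewrite !ffunE.
have E_gt0 m : ~~ coprime m r -> (0 < max_exponent n)%N.
  (* If all exponents are 0 then n = 1, and every m is coprime to r = 1. *)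
  rewrite lt0n; apply: contraNneq => E0.
  have [n1 | n_gt1] : n = 1%N \/ (1 < n)%N by lia.
    by rewrite /r n1 /radn !(big_nil, divn1) coprimen1.
  have : pdiv n \in primes n by rewrite mem_primes pdiv_prime // n_gt0 pdiv_dvd.
  move=> pn; have := @leq_bigmax_seq _ _ xpredT (logn^~ n) _ pn isT.
  by rewrite /= -/(max_exponent n) E0 leqNgt logn_gt0 pn.
have periodicE m : (0 < m)%N -> periodic (fun x : Zmod n => x ^+ m) <-> ~~ coprime m r.
  by move=> m_gt0; rewrite Zmod_periodicP // periodic_exponentP.
have -> : muP (Zmod n) = #|F @: [set k : 'I_N | ~~ coprime k.+1 r]|.
  congr #|pred_of_set _|; apply/setP=> f; rewrite inE.
  apply/asboolP/imsetP => [[[m m_gt0 fm] f_per]|[k k_ncop ->]].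
    have m_ncop : ~~ coprime m r.
      apply/periodicE => //; case: f_per => h h_neq0 h_per.
      by exists h => // x; rewrite -!fm.
    have [k /andP[k_gt0 le_kN] mk] := expn_range n m n_gt0 (E_gt0 m m_ncop) m_gt0.
    have lt_kN : (k.-1 < N)%N by rewrite prednK.
    have {}fm x : f x = x ^+ k.
      by rewrite fm; move: x; apply/Zmod_power_eqP.
    exists (Ordinal lt_kN); last by apply/ffunP=> x; rewrite ffunE fm /= prednK.
    rewrite inE /= prednK //; apply/periodicE => //.
    by case: f_per => h h_neq0 h_per; exists h => // x; rewrite -!fm.
  rewrite inE in k_ncop; split.
    by exists k.+1 => // x; rewrite ffunE.
  have [h h_neq0 h_per] := (periodicE k.+1 isT).2 k_ncop.
  by exists h => // x; rewrite !ffunE.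
rewrite card_imset // big_add1 big_mkord -sum1_card big_mkcond /=.
by apply: eq_bigr => k _; rewrite inE; case: coprime.
Qed.
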